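(* For every real number $s>2$ and every $\varepsilon>0$ there is a positive integer $t$ such that the following holds for all sufficiently large $n$. Let $G$ be an $n$-vertex graph of average degree $d\geq n^{1-\frac{2}{s}+\varepsilon}$. Then there is a non-empty set $R\subset V(G)$ of size at most $t$ such that the induced subgraph $G[R]$ has average degree at least $s$. *)

(* Defs.v *)
From HB Require Import structures.
From mathcomp Require Import all_boot all_order all_algebra.
From mathcomp Require Import reals exp.
Set Implicit Arguments.
Unset Strict Implicit.
Unset Printing Implicit Defensive.
Import Order.TTheory GRing.Theory Num.Theory.
Local Open Scope ring_scope.

Record sgraph := SGraph {
  vertex :> finType;
  adj : rel vertex;
  adj_sym : symmetric adj;
  adj_irrefl : irreflexive adj
}.

Section Induced.
Variables (G : sgraph) (S : {set G}).

Definition induced_adj : rel {x : G | x \in S} := relpre val (@adj G).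

Lemma induced_adj_sym : symmetric induced_adj.
Proof. by move=> x y; exact: adj_sym. Qed.

Lemma induced_adj_irrefl : irreflexive induced_adj.
Proof. by move=> x; exact: adj_irrefl. Qed.

Definition induced : sgraph := SGraph induced_adj_sym induced_adj_irrefl.
End Induced.

Definition degree (G : sgraph) (x : G) : nat := #|[set y | adj x y]|.

(* The value on the graph without vertices is 0, because 0^-1 = 0. *)
Definition avg_degree (R : realType) (G : sgraph) : R :=
  (\sum_(x : G) degree x)%:R / #|G|%:R.

(* Main.v *)
(* Choose integers with q/p < 2/s and (q-1)/p > 2/s - eps, and let T be a
   caterpillar with p edges whose q-1 spine vertices are spread evenly and whose
   remaining p-q+2 vertices are declared to be roots. T is balanced: every set S
   of non-root vertices touches at least (p/q)|S| edges. As in the upper bound of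
   Bukh and Conlon for powers of balanced trees, pass to a subgraph of minimum
   degree at least d/2; counting embeddings of T greedily and applying the
   pigeonhole principle to the images of the roots gives arbitrarily many
   embeddings of T that agree on the roots. Add such copies one at a time, each
   time one not contained in the current vertex set U: by balancedness, each step
   adds at least p/q edges per new vertex. So e(U) >= (p/q)(|U| - O(1)), and since
   p/q > s/2 the average degree is at least s once |U| exceeds a constant. *)
Require Import Defs.
From HB Require Import structures.
From mathcomp Require Import all_boot all_order all_algebra.
From mathcomp Require Import reals exp.
From mathcomp Require Import zify ring lra.
Set Implicit Arguments.
Unset Strict Implicit.
Unset Printing Implicit Defensive.

(** * The balanced caterpillar *)

Section Caterpillar.
Variables p q : nat.

(* The tree has vertices [0, .., p], and each [k > 0] is joined to the last spine
   vertex before it ([0] if there is none). The spine consists of the [k < p]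
   with floor(k q / p) > floor((k - 1) q / p); every other vertex, including the
   two ends [0] and [p] of the path, is a root. *)
Definition spine (k : nat) : bool :=
  (0 < k < p) && (p <= k.-1 * q %% p + q).

Fixpoint parent (k : nat) : nat :=
  if k is j.+1 then if spine j then j else parent j else 0%N.

Lemma parent_le (k : nat) : parent k.+1 <= k.
Proof.
elim: k => [|k IH]; first by rewrite /= /spine.
have -> : parent k.+2 = if spine k.+1 then k.+1 else parent k.+1 by [].
by case: ifP => // _; exact: leqW.
Qed.

Hypothesis q_gt0 : 0 < q.
Hypothesis q_lt : q < p.

(** Spine vertices are by definition the places where adding [q] to the residue modulo [p] produces
    a carry. *)
Lemma residue_step (k : nat) : k.+1 < p ->
  k.+1 * q %% p + spine k.+1 * p = k * q %% p + q.
Proof.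
move=> kp; rewrite /spine /= kp /= mulSn addnC -modnDmr [RHS]addnC.
have lt : k * q %% p < p by rewrite ltn_mod; lia.
rewrite addnC; case: (leqP p (k * q %% p + q)) => h.
  have -> : q + k * q %% p = (q + k * q %% p - p) + p by lia.
  by rewrite modnDr modn_small; lia.
by rewrite modn_small; lia.
Qed.

Lemma residue_last : p.-1 * q %% p = p - q.
Proof.
case: p q_lt => // p' hq /=.
rewrite -(modnMDl 1 (p' * q)) mul1n -[in RHS](modn_small (_ : p'.+1 - q < p'.+1)); last by lia.
have -> : p'.+1 + p' * q = q * p'.+1 + (p'.+1 - q) by nia.
by rewrite modnMDl.
Qed.

(** Summing the carries of [residue_step] gives the quotient of [k * q] by [p]; at [k = p - 1] the
    remainder is [p - q], so the quotient is [q - 1]. *)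
Lemma spine_count : \sum_(1 <= k < p) spine k = q.-1.
Proof.
have H k : k < p ->
    (k * q %% p + p * \sum_(1 <= j < k.+1) spine j = k * q).
  elim: k => [|k IH] kp; first by rewrite mul0n mod0n big_geq // muln0.
  rewrite big_nat_recr //=; have := IH (ltnW kp); have := residue_step kp; nia.
have := H p.-1; rewrite prednK; last by lia.
move=> /(_ ltac:(lia)); rewrite residue_last.
have : p.-1 * q = p * q - q by nia.
have : q <= p * q by nia.
move=> h1 -> h2.
have h3 : p * (\sum_(1 <= k < p) spine k).+1 = p * q by nia.
have : (\sum_(1 <= k < p) spine k).+1 = q by nia.
by move=> <-.
Qed.

(* Between the first edge touching a run of [S] and the edge leaving it the
   deficit [p * #vertices - q * #edges] is governed by the residues
   [k * q %% p]; outside the runs it is nonpositive. *)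
Lemma caterpillar_balanced (S : pred nat) : (forall k, S k -> spine k) ->
  (p * \sum_(1 <= k < p.+1) S k
     <= q * \sum_(1 <= k < p.+1) (S k || S (parent k))).
Proof.
move=> Sspine.
have H k : k < p ->
    (p * \sum_(1 <= j < k.+1) S j + S (parent k.+1) * (k * q %% p)
     <= q * \sum_(1 <= j < k.+1) (S j || S (parent j)) + S (parent k.+1) * p).
  elim: k => [|k IH] kp.
    by rewrite !big_geq // mul0n mod0n !muln0.
  have {IH} := IH (ltnW kp).
  have lt : k * q %% p < p by rewrite ltn_mod; lia.
  have lt' : k.+1 * q %% p < p by rewrite ltn_mod; lia.
  have := residue_step kp.
  rewrite !(big_nat_recr k.+1) //=.
  set P := (if spine k then k else parent k).
  have := Sspine k.+1.
  case: (spine k.+1); case: (S k.+1) => h /=; try (by have := h isT);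
    case: (S P) => /=; nia.
(* The final slack [p - (p - q) = q] is paid by the edge joining the root [p] to its parent. *)
have := H p.-1; rewrite prednK; last by lia.
move=> /(_ ltac:(lia)); rewrite residue_last !(big_nat_recr p) //=; try lia.
have -> : S p = false by apply/negP => /Sspine; rewrite /spine ltnn andbF.
rewrite /=; case: (S (parent p)) => /=; nia.
Qed.

End Caterpillar.

Lemma card_fibers (aT rT : finType) (f : aT -> rT) (A : {set aT}) :
  #|A| = \sum_(y : rT) #|[set x in A | f x == y]|.
Proof.
rewrite -sum1_card (partition_big f predT) //=.
by apply: eq_bigr => y _; rewrite -sum1_card; apply: eq_bigl => x; rewrite inE.
Qed.

(** * Greedy count of tree embeddings *)

Section Embeddings.
Variables (G : sgraph) (p q : nat) (W : {set G}) (x0 : G).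

(* Embeddings into [W] of the vertices [0, .., k] of the tree; the vertices not
   yet embedded carry the dummy value [x0]. *)
Definition partial_emb (k : nat) : {set {ffun 'I_p.+1 -> G}} :=
  [set f : {ffun 'I_p.+1 -> G} |
    [&& [forall i : 'I_p.+1, if i <= k then f i \in W else f i == x0],
        [forall i : 'I_p.+1, forall j : 'I_p.+1,
           [&& i <= k, j <= k & f i == f j] ==> (i == j)] &
        [forall i : 'I_p.+1, (0 < i <= k) ==> adj (f (inord (parent p q i))) (f i)]]].

Lemma partial_embP (k : nat) (f : {ffun 'I_p.+1 -> G}) :
  reflect [/\ forall i : 'I_p.+1, if i <= k then f i \in W else f i == x0,
              forall i j : 'I_p.+1, i <= k -> j <= k -> f i = f j -> i = j
            & forall i : 'I_p.+1, 0 < i <= k -> adj (f (inord (parent p q i))) (f i)]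
          (f \in partial_emb k).
Proof.
rewrite inE; apply: (iffP and3P) => -[h1 h2 h3]; split.
- exact/forallP.
- move=> i j ik jk fij; apply/eqP.
  by move/forallP/(_ i)/forallP/(_ j)/implyP: h2; apply; rewrite ik jk fij /=.
- by move=> i ik; move/forallP/(_ i)/implyP: h3; apply.
- exact/forallP.
- apply/forallP => i; apply/forallP => j; apply/implyP => /and3P[ik jk /eqP fij].
  by apply/eqP/h2.
- by apply/forallP => i; apply/implyP; exact: h3.
Qed.

Lemma card_partial_emb0 : #|W| <= #|partial_emb 0|.
Proof.
pose g (x : G) := [ffun i : 'I_p.+1 => if i == ord0 then x else x0].
have ginj : injective g.
  by move=> x y /ffunP/(_ ord0); rewrite !ffunE eqxx.
rewrite -(card_imset _ ginj); apply/subset_leq_card/subsetP => _ /imsetP[x xW ->].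
apply/partial_embP; split.
- by move=> i; rewrite leqn0 ffunE -val_eqE /=; case: (i == 0 :> nat).
- by move=> i j; rewrite !leqn0 => /eqP i0 /eqP j0 _; apply: val_inj; rewrite /= i0 j0.
- by move=> i /andP[]; case: (nat_of_ord i).
Qed.

(** Vertex [k + 1] can go to any neighbour in [W] of its parent's image except the at most [p]
    images already used, hence the degree bound [m + p]. *)
Lemma card_partial_embS (m k : nat) : k < p ->
  (forall x, x \in W -> m + p <= #|[set y in W | adj x y]|) ->
  #|partial_emb k| * m <= #|partial_emb k.+1|.
Proof.
move=> kp mindeg.
(* [restr] erases the value at [k + 1], and [upd f] maps [new f] injectively into the fibre of
   [restr] over [f]. *)
pose restr (f : {ffun 'I_p.+1 -> G}) :=
  [ffun i : 'I_p.+1 => if i == k.+1 :> nat then x0 else f i].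
pose upd (f : {ffun 'I_p.+1 -> G}) x :=
  [ffun i : 'I_p.+1 => if i == k.+1 :> nat then x else f i].
pose used (f : {ffun 'I_p.+1 -> G}) := [set f i | i in [set i : 'I_p.+1 | i <= k]].
pose new (f : {ffun 'I_p.+1 -> G}) :=
  [set y in W | adj (f (inord (parent p q k.+1))) y] :\: used f.
have valk : (inord k.+1 : 'I_p.+1) = k.+1 :> nat by rewrite inordK.
have par_le i : parent p q i.+1 <= i by exact: parent_le.
have usedk f : #|used f| <= p.
  apply: leq_trans (leq_imset_card _ _) _.
  apply: (@leq_trans #|[set~ (ord_max : 'I_p.+1)]|); last by rewrite cardsC1 card_ord.
  apply/subset_leq_card/subsetP => i; rewrite !inE => ik.
  by rewrite -val_eqE /=; lia.
rewrite (card_fibers restr (partial_emb k.+1)) -sum_nat_const.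
rewrite [leqRHS](bigID (mem (partial_emb k))) /=.
apply: leq_trans (leq_addr _ _); apply: leq_sum => f /partial_embP[fW finj fadj].
have newm : m <= #|new f|.
  have parW : f (inord (parent p q k.+1)) \in W.
    have := fW (inord (parent p q k.+1)); rewrite inordK ?par_le //.
    by have := par_le k; lia.
  have := mindeg _ parW; have := usedk f; have := subset_leq_card (subsetIr
    [set y in W | adj (f (inord (parent p q k.+1))) y] (used f)).
  rewrite /new cardsD; lia.
apply: leq_trans newm _.
have updinj : injective (upd f).
  by move=> x y /ffunP/(_ (inord k.+1)); rewrite !ffunE valk eqxx.
rewrite -(card_imset _ updinj); apply/subset_leq_card/subsetP => _ /imsetP[x xnew ->].
have [xused xW xadj] : [/\ x \notin used f, x \in W & adj (f (inord (parent p q k.+1))) x].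
  by apply/and3P; move: xnew; rewrite !inE.
have xneq (i : 'I_p.+1) : i <= k -> f i <> x.
  by move=> ik fi; move/negP: xused; apply; apply/imsetP; exists i; rewrite ?inE.
have updN (i : 'I_p.+1) : i <= k -> upd f x i = f i.
  by move=> ik; rewrite ffunE; case: eqP => // ik'; rewrite ik' ltnn in ik.
have updE (i : 'I_p.+1) : i = k.+1 :> nat -> upd f x i = x.
  by move=> ik; rewrite ffunE ik eqxx.
have cases (i : 'I_p.+1) : i <= k.+1 -> i = k.+1 :> nat \/ (i <= k).
  by rewrite leq_eqVlt => /orP[/eqP|]; [left|right].
rewrite in_set; apply/andP; split; last first.
  apply/eqP/ffunP => i; rewrite !ffunE; case: eqP => // ik.
  by have := fW i; rewrite ik ltnn => /eqP.
apply/partial_embP; split.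
- move=> i; case: ifP => [/cases[ik|ik]|ik]; first by rewrite updE.
    by rewrite updN //; have := fW i; rewrite ik.
  have ik' : (i <= k) = false by lia.
  rewrite ffunE; case: (nat_of_ord i =P k.+1) => [e|_]; first by rewrite e leqnn in ik.
  by have := fW i; rewrite ik'.
- move=> i j /cases[ik|ik] /cases[jk|jk].
  + by move=> _; apply: val_inj; rewrite /= ik jk.
  + by rewrite updE // updN // => /esym/(xneq _ jk).
  + by rewrite (updE j) // updN // => /(xneq _ ik).
  + by rewrite !updN //; exact: finj.
- move=> i /andP[i0 /cases[ik|ik]].
    rewrite (updE i) // updN; first by rewrite ik.
    by rewrite ik inordK ?par_le // ltnS; have := par_le k; lia.
  have h : parent p q i < i.
    by case: (nat_of_ord i) i0 => // j _; rewrite ltnS.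
  rewrite !updN //; first by rewrite fadj // i0.
  by rewrite inordK; have := ltn_ord i; lia.
Qed.

Lemma card_partial_emb (m : nat) :
  (forall x, x \in W -> m + p <= #|[set y in W | adj x y]|) ->
  #|W| * m ^ p <= #|partial_emb p|.
Proof.
move=> mindeg.
have H k : k <= p -> (#|W| * m ^ k <= #|partial_emb k|).
  elim: k => [|k IH] kp; first by rewrite expn0 muln1 card_partial_emb0.
  rewrite expnSr mulnA; apply: leq_trans (card_partial_embS kp mindeg).
  by rewrite leq_mul2r IH ?orbT // ltnW.
exact: H.
Qed.

(** * Pigeonhole on the roots and unions of embeddings *)

Hypothesis q_gt0 : 0 < q.
Hypothesis q_lt : q < p.

Lemma card_roots : #|[pred i : 'I_p.+1 | ~~ spine p q i]| = (p - q).+2.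
Proof.
have := cardC [pred i : 'I_p.+1 | spine p q i].
have -> : #|[pred i : 'I_p.+1 | spine p q i]| = q.-1.
  rewrite -(spine_count q_gt0 q_lt) -sum1_card big_mkcond /=.
  rewrite -(big_mkord xpredT (fun i => if spine p q i then 1 else 0)).
  rewrite big_nat_recr //= big_ltn; last by lia.
  rewrite {1}/spine /= add0n {2}/spine ltnn andbF addn0.
  by apply: eq_bigr => i _; case: spine.
rewrite card_ord => h.
rewrite -(eq_card (_ : [predC [pred i : 'I_p.+1 | spine p q i]] =i _)) //.
by apply: (@addnI q.-1); rewrite h; lia.
Qed.

Definition rooted_emb (y : 'I_p.+1 -> G) : {set {ffun 'I_p.+1 -> G}} :=
  [set f in partial_emb p | [forall i : 'I_p.+1, ~~ spine p q i ==> (f i == y i)]].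

Lemma rooted_pigeonhole (M : nat) :
  #|W| ^ (p - q).+2 * M < #|partial_emb p| ->
  exists y : 'I_p.+1 -> G, (M < #|rooted_emb y|).
Proof.
move=> big.
(* Overwriting spine values by [x0] leaves only the root images, so on embeddings [roots] takes
   values in [family F]. *)
pose roots (f : {ffun 'I_p.+1 -> G}) :=
  [ffun i : 'I_p.+1 => if spine p q i then x0 else f i].
pose F (i : 'I_p.+1) := if spine p q i then pred1 x0 else mem W.
have cardF : #|family F| = (#|W| ^ (p - q).+2).
  rewrite card_family -card_roots foldrE big_map big_enum /=.
  rewrite -prod_nat_const [LHS](bigID (fun i : 'I_p.+1 => spine p q i)) /=.
  rewrite big1 ?mul1n => [|i si]; last by rewrite /F si card1.
  by apply: eq_bigr => i /negbTE si; rewrite /F si.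
have [/existsP[y My]|/existsPn small] :=
  boolP [exists y, M < #|[set f in partial_emb p | roots f == y]|].
  exists y; apply: leq_trans My _; apply/subset_leq_card/subsetP => f.
  rewrite !in_set => /andP[-> /eqP <-]; apply/forallP => i.
  by rewrite ffunE; case: spine => //=.
move: big; rewrite ltnNge => /negP[]; rewrite (card_fibers roots) -cardF -sum_nat_const.
rewrite [leqLHS](bigID (mem (family F))) /= [X in _ + X]big1 ?addn0.
  by apply: leq_sum => y _; rewrite leqNgt small.
move=> y /negP yF; apply/eqP; rewrite cards_eq0; apply/eqP/setP => f.
rewrite in_set in_set0; apply/negP => /andP[/partial_embP[fW _ _] /eqP fy]; apply: yF.
apply/familyP => i; rewrite -fy ffunE /F; case: spine; rewrite inE //.
by have := fW i; rewrite -ltnS ltn_ord.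
Qed.

(** Ordered pairs count each edge twice, which is the source of the factor 2 in [2 * p] below. *)
Definition adj_pairs (U : {set G}) : {set G * G} :=
  [set u | [&& u.1 \in U, u.2 \in U & adj u.1 u.2]].

(** The tree vertices sent outside [U] form a set [S] of spine vertices, and each tree edge touching
    [S] gives a new edge; [caterpillar_balanced] compares the two counts. *)
Lemma add_embedding (U : {set G}) (f : {ffun 'I_p.+1 -> G}) :
  f \in partial_emb p -> (forall i : 'I_p.+1, ~~ spine p q i -> f i \in U) ->
  2 * p * #|U :|: [set f i | i : 'I_p.+1]| + q * #|adj_pairs U|
    <= q * #|adj_pairs (U :|: [set f i | i : 'I_p.+1])| + 2 * p * #|U|.
Proof.
move=> /partial_embP[_ finj fadj] rootsU.
set U' := U :|: _.
pose S k := (k < p.+1) && (f (inord k) \notin U).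
have Sord (i : 'I_p.+1) : S i = (f i \notin U) by rewrite /S ltn_ord inord_val.
have Sspine k : S k -> spine p q k.
  move=> /andP[kp]; apply: contraNT => sk; apply: rootsU; by rewrite inordK.
have par_lt (i : 'I_p.+1) : 0 < i -> (parent p q i < i).
  by case: (nat_of_ord i) => // j _; rewrite ltnS parent_le.
have valpar (i : 'I_p.+1) : 0 < i -> (inord (parent p q i) : 'I_p.+1) = parent p q i :> nat.
  by move=> i0; rewrite inordK //; have := par_lt _ i0; have := ltn_ord i; lia.
have leip (i : 'I_p.+1) : i <= p by rewrite -ltnS.
have fI : injective f by move=> i j; exact: finj.
pose T := [set i : 'I_p.+1 | (0 < i) && (S i || S (parent p q i))].
have cardT : #|T| = (\sum_(1 <= k < p.+1) (S k || S (parent p q k))).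
  rewrite -sum1_card big_mkcond /=.
  rewrite (eq_bigr (fun i : 'I_p.+1 => (((0 < i) && (S i || S (parent p q i))) : nat))).
    rewrite -(big_mkord xpredT (fun i => (((0 < i) && (S i || S (parent p q i))) : nat))).
    by rewrite big_ltn //= add0n; apply: eq_big_nat => -[].
  by move=> i _; rewrite inE; case: ifP.
have cardU' : #|U'| <= #|U| + \sum_(1 <= k < p.+1) S k.
  have <- : #|[set i : 'I_p.+1 | S i]| = \sum_(1 <= k < p.+1) S k.
    rewrite -sum1_card big_mkcond /=.
    rewrite (eq_bigr (fun i : 'I_p.+1 => S i : nat)); last first.
      by move=> i _; rewrite inE; case: ifP.
    rewrite -(big_mkord xpredT (fun i => S i : nat)) big_ltn //.
    by case S0: (S 0) => //; have := Sspine _ S0.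
  apply: leq_trans (leq_add (leqnn _) (leq_imset_card f _)).
  apply: leq_trans (leq_card_setU _ _).1; apply/subset_leq_card/subsetP => x.
  rewrite !inE => /orP[->//|/imsetP[i _ ->]].
  by have [//|fU] := boolP (f i \in U); rewrite imset_f ?inE ?Sord // orbT.
pose e (i : 'I_p.+1) := (f (inord (parent p q i)), f i).
pose e' (i : 'I_p.+1) := (f i, f (inord (parent p q i))).
have einj : injective e by move=> i j [_ /fI].
have e'inj : injective e' by move=> i j [/fI].
have TU i : i \in T -> ((e i).1 \in U) && ((e i).2 \in U) = false.
  rewrite inE => /andP[i0]; rewrite Sord -[X in S X](valpar _ i0) Sord /=.
  by case: (f i \in U); case: (_ \in U).
(* Parents have smaller indices, so no tree edge is the reversal of another. *)
have disj : [disjoint e @: T & e' @: T].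
  apply/pred0P => u /=; apply/negP => /andP[/imsetP[i iT ->] /imsetP[j jT [/fI ij /fI ji]]].
  move: iT jT; rewrite !inE => /andP[i0 _] /andP[j0 _].
  have := par_lt _ i0; have := par_lt _ j0.
  by rewrite -(valpar _ i0) -(valpar _ j0) ij -ji; lia.
have disjU : [disjoint adj_pairs U & e @: T :|: e' @: T].
  apply/pred0P => u /=; apply/negP => /andP[]; rewrite !inE => /and3P[u1 u2 _].
  by move=> /orP[] /imsetP[i /TU + ui]; rewrite ui /= in u1 u2 *; rewrite u1 u2.
have sub : adj_pairs U :|: (e @: T :|: e' @: T) \subset adj_pairs U'.
  have fU' i : f i \in U' by rewrite inE imset_f ?orbT.
  apply/subsetP => u; rewrite !inE => /orP[/and3P[-> -> ->]//|].
  move=> /orP[] /imsetP[i]; rewrite inE => /andP[i0 _] -> /=.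
    by rewrite -!in_setU !fU' fadj // i0 leip.
  by rewrite -!in_setU !fU' adj_sym fadj // i0 leip.
have := subset_leq_card sub.
move: (leq_card_setU (adj_pairs U) (e @: T :|: e' @: T)).2; rewrite disjU => /eqP ->.
move: (leq_card_setU (e @: T) (e' @: T)).2; rewrite disj => /eqP ->.
rewrite !card_imset // cardT.
have := caterpillar_balanced q_gt0 q_lt Sspine; nia.
Qed.

(** Starting from the root images, whose at most [p + 1] vertices cause the additive error,
    embeddings are added until [U] has [K] vertices. *)
Lemma dense_union (K : nat) (y : 'I_p.+1 -> G) :
  K ^ p.+1 < #|rooted_emb y| ->
  exists U : {set G}, [/\ K <= #|U|, #|U| <= K + p.+1
    & (2 * p * #|U| <= q * #|adj_pairs U| + 2 * p * p.+1)].
Proof.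
move=> many.
have imcard (g : 'I_p.+1 -> G) (A : {set 'I_p.+1}) : #|g @: A| <= p.+1.
  by apply: leq_trans (leq_imset_card _ _) _; rewrite -[leqRHS]card_ord max_card.
suff [U [h1 h2 h3 _]] : exists U : {set G}, [/\ K <= #|U|, #|U| <= K + p.+1,
    (2 * p * #|U| <= q * #|adj_pairs U| + 2 * p * p.+1)
    & forall i : 'I_p.+1, ~~ spine p q i -> y i \in U] by exists U.
elim: K many => [|j IH] many.
  exists (y @: [set i : 'I_p.+1 | ~~ spine p q i]); split=> //.
    apply: leq_trans (leq_addl _ _); rewrite leq_mul2l imcard; exact: orbT.
  by move=> i si; rewrite imset_f ?inE.
have {IH} [|U [jU Uj dU yU]] := IH.
  by apply: leq_ltn_trans many; rewrite leq_exp2r.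
(* A copy is added only when [#|U|] is exactly [j]. Then at most [j ^ p.+1] embeddings lie inside
   [U], so some rooted one leaves it. *)
case: (leqP j.+1 #|U|) => [jU'|Uj']; first by exists U; split=> //; lia.
have {jU Uj'} Uj' : #|U| = j by lia.
have [f fPhi /subsetPn[x /imsetP[i _ xi] xU]] :
    exists2 f : {ffun 'I_p.+1 -> G}, f \in rooted_emb y & ~~ (f @: 'I_p.+1 \subset U).
  apply/exists_inP; apply: contraLR many => /exists_inPn sub.
  rewrite -leqNgt; apply: (@leq_trans #|ffun_on (mem U) : {pred {ffun 'I_p.+1 -> G}}|).
    apply/subset_leq_card/subsetP => f /sub; rewrite negbK => /subsetP fU.
    by apply/ffun_onP => i; apply: fU; rewrite imset_f.
  by rewrite card_ffun_on card_ord Uj' leq_exp2r.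
move: fPhi; rewrite in_set => /andP[femb /forallP fy].
have fE (i' : 'I_p.+1) : ~~ spine p q i' -> f i' = y i'.
  by move=> si; apply/eqP; have := fy i'; rewrite /= si.
exists (U :|: [set f i | i : 'I_p.+1]); split.
- rewrite -Uj'; apply: proper_card; apply/properP; split; first exact: subsetUl.
  by exists x; rewrite // inE xi imset_f ?orbT.
- apply: leq_trans (leq_card_setU _ _).1 _; rewrite Uj'.
  apply: (@leq_trans (j + p.+1)); last by rewrite addSn.
  rewrite leq_add2l.
  by apply: leq_trans (leq_imset_card _ _) _; rewrite card_ord.
- have h (i' : 'I_p.+1) : ~~ spine p q i' -> f i' \in U by move=> si; rewrite fE ?yU.
  by have := add_embedding femb h; lia.
- by move=> i' si; rewrite inE yU.
Qed.

End Embeddings.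

Import Order.TTheory GRing.Theory Num.Theory.
Local Open Scope ring_scope.

(** * Degree sums and a subgraph of large minimum degree *)

Lemma card_adj_pairs (G : sgraph) (U : {set G}) :
  #|adj_pairs U| = (\sum_(x in U) #|[set y in U | adj x y]|)%N.
Proof.
rewrite (card_fibers fst) (bigID (mem U)) /= [X in (_ + X)%N]big1 ?addn0.
  apply: eq_bigr => x xU.
  have inj : injective (pair x : G -> G * G) by move=> y z [].
  rewrite -(card_imset _ inj); apply: eq_card => -[a b]; rewrite !inE /=.
  apply/andP/imsetP => [[/and3P[aU bU ab] /eqP <-]|[y]].
    by exists b; rewrite ?inE ?bU.
  by rewrite inE => /andP[yU xy] [-> ->]; rewrite xU yU xy.
move=> x /negbTE xU; apply/eqP; rewrite cards_eq0; apply/eqP/setP => u.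
by rewrite !inE; case: eqP => [->|_]; rewrite ?xU ?andbF.
Qed.

Lemma avg_degree_induced (R : realType) (G : sgraph) (U : {set G}) :
  avg_degree R (induced U) = #|adj_pairs U|%:R / #|U|%:R.
Proof.
rewrite /avg_degree card_adj_pairs /= card_sig; congr (_%:R / _).
rewrite [RHS]big_sub; apply: eq_bigr => x _; rewrite /degree -(card_imset _ val_inj).
apply: eq_card => y; rewrite !inE; apply/imsetP/andP.
  by move=> [z]; rewrite inE => xz ->; split=> //; exact: valP.
by move=> [yU xy]; exists (Sub y yU); rewrite ?inE.
Qed.

Lemma avg_degreeT (R : realType) (G : sgraph) :
  avg_degree R G = #|adj_pairs [set: G]|%:R / #|G|%:R.
Proof.
rewrite /avg_degree card_adj_pairs; congr (_%:R / _).
apply: eq_big => [x|x _]; first by rewrite inE.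
by apply: eq_card => y; rewrite !inE.
Qed.

(** In a minimal non-empty [W] of average degree at least [d], deleting a vertex of degree below
    [d / 2] would lose fewer than [d] ordered pairs and keep the average. *)
Lemma exists_min_degree (R : realType) (G : sgraph) (d : R) :
  0 < d -> (0 < #|G|)%N -> d <= avg_degree R G ->
  exists2 W : {set G}, W != set0 &
    forall x, x \in W -> d <= 2 * #|[set y in W | adj x y]|%:R.
Proof.
move=> d0 G0; rewrite avg_degreeT ler_pdivlMr ?ltr0n // => dG.
pose P (W : {set G}) := (W != set0) && (d * #|W|%:R <= #|adj_pairs W|%:R).
have PT : P setT by rewrite /P -card_gt0 cardsT G0.
have [W /minsetP[/andP[W0 dW] Wmin] _] := minset_exists PT.
exists W => // x xW; rewrite leNgt; apply/negP => degx.
have Wx : (#|W| = #|W :\ x|.+1)%N by rewrite (cardsD1 x) xW.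
have pairs_le : (#|adj_pairs W|
    <= #|adj_pairs (W :\ x)| + 2 * #|[set y in W | adj x y]|)%N.
  have inj1 : injective (pair x : G -> G * G) by move=> y z [].
  have inj2 : injective (fun y : G => (y, x)) by move=> y z [].
  set N := [set y in W | adj x y].
  have -> : (2 * #|N| = #|pair x @: N| + #|(fun y : G => (y, x)) @: N|)%N.
    by rewrite !card_imset // mul2n addnn.
  apply: leq_trans (leq_add (leqnn _) (leq_card_setU _ _).1).
  apply: leq_trans (leq_card_setU _ _).1.
  apply/subset_leq_card/subsetP => -[a b]; rewrite !inE /= => /and3P[aW bW ab].
  have [ax|ax] /= := eqVneq a x.
    by rewrite -ax (_ : _ \in _) ?orbT // imset_f // !inE bW -ax.
  have [bx|bx] /= := eqVneq b x.
    rewrite -bx (_ : (a, b) \in (fun y : G => (y, b)) @: N) ?orbT //.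
    by rewrite (imset_f (fun y => (y, b))) // !inE aW -bx adj_sym.
  by rewrite aW bW ab.
have Wx_le : d * #|W :\ x|%:R <= #|adj_pairs (W :\ x)|%:R.
  have : (#|adj_pairs W|%:R : R)
    <= #|adj_pairs (W :\ x)|%:R + 2 * #|[set y in W | adj x y]|%:R.
    by rewrite -natrM -natrD ler_nat.
  move: dW; rewrite Wx -natr1; lra.
have [Wx0|Wx0] := eqVneq (W :\ x) set0; last first.
  have := Wmin (W :\ x); rewrite /P Wx0 Wx_le => /(_ isT (subsetDl _ _)) /setP/(_ x).
  by rewrite !inE eqxx xW.
(* Here [W] is the single vertex [x], which spans no edge, contradicting [0 < d]. *)
have N0 : #|[set y in W | adj x y]| = 0%N.
  apply/eqP; rewrite cards_eq0; apply/eqP/setP => y; rewrite !inE.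
  apply/negP => /andP[yW xy]; have := in_set0 y; rewrite -Wx0 !inE yW andbT.
  by move/negbFE/eqP => yx; rewrite yx adj_irrefl in xy.
have A0 : #|adj_pairs (W :\ x)| = 0%N.
  by apply/eqP; rewrite cards_eq0; apply/eqP/setP => u; rewrite !inE -!in_setD1 Wx0 !inE.
move: dW pairs_le; rewrite N0 A0 leqn0 Wx Wx0 cards0 => dW /eqP h.
by move: dW; rewrite h mulr1 leNgt d0.
Qed.

(** * Choice of parameters and conclusion *)

Lemma exists_ratio (R : realType) (th eps : R) : 0 < th -> th < 1 -> 0 < eps ->
  exists p q : nat, [/\ (0 < q)%N, (q < p)%N, q%:R < p%:R * th
    & p%:R * (th - eps) < q%:R - 1].
Proof.
move=> th0 th1 eps0.
have e1 : 0 < 3 / eps by apply: divr_gt0.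
have e2 : 0 < 2 / th by apply: divr_gt0.
have [p pge] : exists p : nat, 3 / eps + 2 / th < p%:R.
  by exists (Num.truncn (3 / eps + 2 / th)).+1; exact: truncnS_gt.
have p3 : 3 < p%:R * eps by rewrite -ltr_pdivrMr //; lra.
have p2 : 2 < p%:R * th by rewrite -ltr_pdivrMr //; lra.
have p0 : 0 < p%:R :> R by rewrite (lt_trans _ pge) // addr_gt0.
have p2' : 0 <= p%:R * th by lra.
have /andP[t1 t2] := truncn_itv p2'.
have tr2 : (1 < Num.truncn (p%:R * th))%N by rewrite truncn_gt_nat ltW.
(* Subtracting 1 makes [q < p * th] strict. Then [q - 1 > p * th - 3], so [p * eps > 3] suffices,
   and [p * th > 2] keeps [q] positive. *)
exists p, (Num.truncn (p%:R * th)).-1.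
move: t1 t2 tr2; case: (Num.truncn _) => // k; rewrite -!natr1 /= => t1 t2 k0.
split=> //; [| lra | by rewrite mulrBr; lra].
have : p%:R * th < p%:R by rewrite gtr_pMr.
by rewrite -(ltr_nat R); lra.
Qed.

Lemma powR_unbounded (R : realType) (a C : R) : 0 < a ->
  exists N : nat, forall n : nat, (N <= n)%N -> C < n%:R `^ a.
Proof.
move=> a0; pose C' := Num.max C 1.
have C'0 : 0 < C' by rewrite lt_max ltr01 orbT.
exists (Num.truncn (C' `^ a^-1)).+1 => n Nn.
have h : C' `^ a^-1 < n%:R.
  by apply: lt_le_trans (truncnS_gt _) _; rewrite ler_nat.
apply: le_lt_trans (_ : C' < _); first by rewrite le_max lexx.
have -> : C' = (C' `^ a^-1) `^ a by rewrite -powRrM mulVf ?gt_eqF // powRr1 ?ltW.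
by apply: gt0_ltr_powR; rewrite ?nnegrE ?powR_ge0 //.
Qed.

Theorem theorem1p4 (R : realType) (s eps : R) (hs : 2 < s) (heps : 0 < eps) :
  exists t : nat, (0 < t)%N /\
  exists N : nat, forall n : nat, (N <= n)%N ->
  forall G : sgraph, #|G| = n ->
    n%:R `^ (1 - 2 / s + eps) <= avg_degree R G ->
  exists S : {set G}, [/\ S != set0, (#|S| <= t)%N & s <= avg_degree R (induced S)].
Proof.
have s0 : 0 < s by lra.
have th0 : 0 < 2 / s by apply: divr_gt0.
have th1 : 2 / s < 1 by rewrite ltr_pdivrMr // mul1r.
have [p [q [q0 qp qth etagt]]] := exists_ratio th0 th1 heps.
have p0 : (0 < p)%N by exact: leq_ltn_trans qp.
have gap : 0 < 2 * p%:R - s * q%:R.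
  by move: qth; rewrite mulrA ltr_pdivlMr // subr_gt0 mulrC [X in _ < X]mulrC.
(* Chosen so that [2 * p * #|U| - 2 * p * p.+1] is at least [s * q * #|U|] once [#|U|] reaches
   [K]. *)
pose K := (Num.truncn (2 * p%:R * p.+1%:R / (2 * p%:R - s * q%:R))).+1.
have Kbig : 2 * p%:R * p.+1%:R <= K%:R * (2 * p%:R - s * q%:R).
  by rewrite -ler_pdivrMr //; apply/ltW/truncnS_gt.
set beta := 1 - 2 / s + eps.
have beta0 : 0 < beta by rewrite /beta; lra.
(* The spare exponent: [p * beta = eta + (p - q + 1)]. *)
pose eta : R := q%:R - 1 - p%:R * (2 / s - eps).
have eta0 : 0 < eta by rewrite /eta subr_gt0.
(* With [m] the integer part of [n ^ beta / 4], the bound [8 * p] gives both [m + p <= n ^ beta / 2]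
   and [m >= n ^ beta / 8]. *)
have [N1 HN1] := powR_unbounded (8 * p%:R) beta0.
have [N2 HN2] := powR_unbounded (8 ^+ p * K%:R ^+ p.+1) eta0.
exists (K + p.+1)%N; split; first by rewrite addnS.
exists (maxn 1 (maxn N1 N2)) => n; rewrite !geq_max => /and3P[n0 /HN1 nbeta /HN2 neta].
move=> G cardG degG.
have p1 : 1 <= p%:R :> R by rewrite ler1n.
have nb0 : 0 < n%:R `^ beta by apply: powR_gt0; rewrite ltr0n.
have [|W /set0Pn[x0 x0W] Wdeg] := exists_min_degree nb0 _ degG; first by rewrite cardG.
have [m m1 m2] : exists2 m : nat, m%:R <= n%:R `^ beta / 4 & n%:R `^ beta / 4 < m%:R + 1.
  have nb4 : 0 <= n%:R `^ beta / 4 by lra.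
  exists (Num.truncn (n%:R `^ beta / 4)); have /andP[? ?] := truncn_itv nb4 => //.
  by rewrite natr1.
have Wm x : x \in W -> (m + p <= #|[set y in W | adj x y]|)%N.
  by move=> /Wdeg; rewrite -(ler_nat R) natrD; lra.
have W0 : (0 < #|W|)%N by apply/card_gt0P; exists x0.
(* One factor [#|W|] is cancelled between the [#|W| * m ^ p] embeddings and the [#|W| ^ (p - q).+2]
   root patterns. *)
have bigm : (#|W| ^ (p - q).+1 * K ^ p.+1 < m ^ p)%N.
  apply: (@leq_ltn_trans (n ^ (p - q).+1 * K ^ p.+1)).
    by rewrite leq_mul2r leq_exp2r // -cardG max_card orbT.
  rewrite -(ltr_nat R) natrM !natrX.
  have mge : n%:R `^ beta / 8 <= m%:R by lra.
  apply: (@lt_le_trans _ _ ((n%:R `^ beta / 8) ^+ p)); last first.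
    by apply: lerXn2r; rewrite ?nnegrE //; lra.
  rewrite expr_div_n ltr_pdivlMr ?exprn_gt0 //.
  have -> : (n%:R `^ beta) ^+ p = n%:R `^ eta * n%:R ^+ (p - q).+1 :> R.
    rewrite -!powR_mulrn ?powR_ge0 // -powRrM -powRD; last first.
      by rewrite pnatr_eq0 -lt0n n0 implybT.
    congr (_ `^ _); rewrite -natr1 natrB ?(ltnW qp) // /eta /beta; ring.
  by rewrite -mulrA mulrC ltr_pM2r ?exprn_gt0 ?ltr0n // mulrC.
have [y /(dense_union q0 qp)[U [KU UK Udense]]] :
    exists y : 'I_p.+1 -> G, (K ^ p.+1 < #|rooted_emb q W x0 y|)%N.
  apply: rooted_pigeonhole => //; apply: leq_trans (card_partial_emb q x0 Wm).
  by rewrite expnS -mulnA ltn_pmul2l.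
have U0 : (0 < #|U|)%N by exact: leq_trans KU.
exists U; split=> //; first by rewrite -card_gt0.
rewrite avg_degree_induced ler_pdivlMr ?ltr0n //.
move: Udense; rewrite -(ler_nat R) natrD !natrM => Udense.
have qR : 0 < q%:R :> R by rewrite ltr0n.
have Ubig : 2 * p%:R * p.+1%:R <= #|U|%:R * (2 * p%:R - s * q%:R).
  by apply: le_trans Kbig _; rewrite ler_pM2r // ler_nat.
rewrite -(ler_pM2l qR); lra.
Qed.
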